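(* Let $\Gamma$ be a weighted directed multigraph without loops on vertex set $\{1,\dots,n\}$, $n>1$, with positive arc weights. For $i,j\in V(\Gamma)$ let $f_{ij}$ be the total weight of all spanning converging forests of $\Gamma$ in which vertex $i$ belongs to a tree converging to (rooted at) $j$. Then for every $i,j,k\in V(\Gamma)$, $$f_{ij}\,f_{jk}\le f_{ik}\,f_{jj}.$$ Moreover, $f_{ij}\,f_{jk}= f_{ik}\,f_{jj}$ if and only if every directed path from $i$ to $k$ in $\Gamma$ contains $j$.
   Context: A converging tree is a weakly connected weighted digraph in which one vertex, the root, has outdegree zero and every other vertex has outdegree one. A converging forest is a weighted digraph all of whose weakly connected components are converging trees; a spanning converging forest of $\Gamma$ is a spanning subgraph of $\Gamma$ that is a converging forest. The weight of a digraph is the product of the weights of its arcs (equal to 1 if it has no arcs); the weight of a set of digraphs is the sum of the weights of its members (0 for the empty set). *)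

(* Defs.v *)
From mathcomp Require Import all_boot all_order all_algebra.
Set Implicit Arguments.
Unset Strict Implicit.
Unset Printing Implicit Defensive.
Import Order.TTheory GRing.Theory Num.Theory.
Local Open Scope ring_scope.

(* Arcs form a type of their own, so parallel arcs are distinct objects.      *)
Record wmultidigraph (R : realFieldType) (V : finType) := WMultidigraph {
  arc : finType;
  src : arc -> V;
  tgt : arc -> V;
  arc_weight : arc -> R
}.

Section Forests.

Variables (R : realFieldType) (V : finType) (G : wmultidigraph R V).

Definition loopless : Prop := forall e : arc G, src e != tgt e.

Definition positive_weights : Prop := forall e : arc G, 0 < arc_weight e.

Definition adj : rel V :=
  fun x y => [exists e : arc G, (src e == x) && (tgt e == y)].

(* i :: p is the vertex sequence of a directed path of G from i to k; the     *)
(* one-vertex path (p empty, i = k) is allowed.                               *)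
Definition dipath (i : V) (p : seq V) (k : V) : bool :=
  [&& path adj i p, last i p == k & uniq (i :: p)].

(* Below, a subgraph of G is given by a vertex set S and an arc set A whose   *)
(* arcs have both ends in S; a spanning subgraph is given by A alone.         *)

Definition weight (A : {set arc G}) : R := \prod_(e in A) arc_weight e.

Definition outdeg (A : {set arc G}) (v : V) : nat :=
  #|[set e in A | src e == v]|.

Definition weak_adj (A : {set arc G}) : rel V :=
  fun x y => [exists e in A, ((src e == x) && (tgt e == y))
                          || ((src e == y) && (tgt e == x))].

Definition weakly_connected (S : {set V}) (A : {set arc G}) : bool :=
  [forall x in S, forall y in S, connect (weak_adj A) x y].

Definition converging_tree_to (S : {set V}) (A : {set arc G}) (r : V) : bool :=
  [&& weakly_connected S A, r \in S, outdeg A r == 0%N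
    & [forall v in S, (v != r) ==> (outdeg A v == 1%N)]].

Definition converging_tree (S : {set V}) (A : {set arc G}) : bool :=
  [exists r, converging_tree_to S A r].

(* Vertex set and arc set of the weakly connected component of x in the       *)
(* spanning subgraph with arc set A.                                          *)
Definition comp_verts (A : {set arc G}) (x : V) : {set V} :=
  [set y | connect (weak_adj A) x y].

Definition comp_arcs (A : {set arc G}) (x : V) : {set arc G} :=
  [set e in A | (src e \in comp_verts A x) && (tgt e \in comp_verts A x)].

Definition spanning_converging_forest (A : {set arc G}) : bool :=
  [forall x, converging_tree (comp_verts A x) (comp_arcs A x)].

Definition in_tree_converging_to (A : {set arc G}) (i j : V) : bool :=
  converging_tree_to (comp_verts A i) (comp_arcs A i) j.

Definition forest_weight (i j : V) : R :=
  \sum_(A : {set arc G} | spanning_converging_forest A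
                          && in_tree_converging_to A i j) weight A.

End Forests.

(* Main.v *)
(* For a fixed root r, deleting the arc leaving v from a forest shows that
   x |-> f_xr is harmonic away from r: (1 + d_v) f_vr is the sum of
   w(e) f_(tgt e)r over the arcs e leaving v, where d_v is their total weight.
   Hence the gap y_v = f_vk f_jj - f_vj f_jk vanishes at j, is harmonic off j
   and k, and is strictly superharmonic at k when k <> j.  The minimum principle
   for this strictly diagonally dominant system gives y >= 0.  A zero of y other
   than j is not k and propagates along all outgoing arcs, so a path from it to k
   has to meet j.  Conversely, if all paths from i to k meet j, then the minimum
   principle applied to -y, cut off outside the vertices reachable from i while
   avoiding j, gives y_i <= 0. *)
Require Import Defs.
From mathcomp Require Import all_boot all_order all_algebra.
From mathcomp Require Import ring.
Set Implicit Arguments.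
Unset Strict Implicit.
Unset Printing Implicit Defensive.
Import Order.TTheory GRing.Theory Num.Theory.
Local Open Scope ring_scope.

(** * Reachability along arcs and sinks of partial functions *)

Lemma connect_invariant (T : finType) (e : rel T) (P : pred T) x y :
  (forall a b, e a b -> P a -> P b) -> connect e x y -> P x -> P y.
Proof.
move=> eP /connectP[p xp ->]; elim: p x xp => //= a p IH x /andP[xa ap] Px.
exact: IH ap (eP _ _ xa Px).
Qed.

Section ForestWeights.

Variables (R : realFieldType) (V : finType) (G : wmultidigraph R V).
Implicit Types (A : {set Defs.arc G}) (e : Defs.arc G) (u v x y r : V).

(* [Defs.arc] has to be qualified, as [arc] now denotes the one of path.v. *)
Definition step A : rel V := fun x y => [exists e in A, (src e == x) && (tgt e == y)].

Definition partial_function A : bool := [forall v, (outdeg A v <= 1)%N].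

(** Directed counterpart of [in_tree_converging_to], with which it agrees on partial functions; it
    mentions no weak component, so the effect of one more arc is easy to follow. *)
Definition drains A x r : bool := connect (step A) x r && (outdeg A r == 0%N).

Lemma stepP A x y :
  reflect (exists e, [/\ e \in A, src e = x & tgt e = y]) (step A x y).
Proof.
apply: (iffP exists_inP) => [[e eA /andP[/eqP sx /eqP ty]]|[e [eA sx ty]]];
  by exists e; rewrite ?sx ?ty ?eqxx.
Qed.

Lemma step_weak A x y : step A x y -> weak_adj A x y.
Proof.
by case/stepP=> e [eA sx ty]; apply/exists_inP; exists e; rewrite ?sx ?ty ?eqxx.
Qed.

Lemma weak_adj_step A x y : weak_adj A x y = step A x y || step A y x.
Proof.
apply/idP/orP => [/exists_inP[e eA /orP[]/andP[/eqP s /eqP t]]|].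
- by left; apply/stepP; exists e.
- by right; apply/stepP; exists e.
by case=> /stepP[e [eA s t]]; apply/exists_inP; exists e; rewrite ?s ?t ?eqxx ?orbT.
Qed.

Lemma weak_adj_sym A : connect_sym (weak_adj A).
Proof.
by apply: sym_connect_sym => x y; rewrite !weak_adj_step orbC.
Qed.

Lemma connect_step_weak A x y : connect (step A) x y -> connect (weak_adj A) x y.
Proof. by apply: connect_sub => a b /step_weak; apply: connect1. Qed.

Lemma outdeg_eq0P A v :
  reflect (forall e, e \in A -> src e != v) (outdeg A v == 0%N).
Proof.
rewrite /outdeg cards_eq0; apply: (iffP eqP) => [A0 e eA | noe].
  by apply/negP => sv; have := in_set0 e; rewrite -A0 inE eA sv.
by apply/setP => e; rewrite !inE; apply/negP => /andP[/noe/negP].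
Qed.

Lemma outdeg_gt0P A v : reflect (exists y, step A v y) (0 < outdeg A v)%N.
Proof.
rewrite /outdeg card_gt0; apply: (iffP (set0Pn _)) => [[e]|[y /stepP[e [eA s t]]]].
  by rewrite inE => /andP[eA /eqP s]; exists (tgt e); apply/stepP; exists e.
by exists e; rewrite inE eA s eqxx.
Qed.

Lemma sink_connect A r y : outdeg A r == 0%N -> connect (step A) r y -> y = r.
Proof.
move=> r0 /connectP[[|z p] //= /andP[rz _] _].
by move: r0; rewrite eqn0Ngt => /outdeg_gt0P[]; exists z.
Qed.

Lemma step_functional A x y z :
  partial_function A -> step A x y -> step A x z -> y = z.
Proof.
move=> /forallP/(_ x)/card_le1_eqP A1 /stepP[e [eA es <-]] /stepP[e' [e'A e's <-]].
by congr tgt; apply: A1; rewrite inE ?eA ?e'A ?es ?e's eqxx.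
Qed.

(** Since [x != z], the path to [z] has a first step, and that step can only go to [y]. *)
Lemma connect_next A x y z : partial_function A ->
  step A x y -> connect (step A) x z -> x != z -> connect (step A) y z.
Proof.
move=> Af xy /connectP[[|a p] /=]; first by move=> _ ->; rewrite eqxx.
case/andP=> xa ap -> _; rewrite (step_functional Af xy xa).
by apply/connectP; exists p.
Qed.

(* Undirected connectedness suffices: the set of vertices leading to r is stable
   backwards, and stable forwards because r has no successor and every other
   vertex has only one. *)
Lemma weak_component_drains A x y r : partial_function A ->
  drains A x r -> connect (weak_adj A) x y -> drains A y r.
Proof.
move=> Af /andP[xr r0] xy; rewrite /drains r0 andbT.
apply: (connect_invariant (P := fun z => connect (step A) z r)) xy xr => a b.
rewrite weak_adj_step => /orP[ab ar|ba ar]; last exact: connect_trans (connect1 ba) ar.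
apply: (connect_next Af ab ar); apply/eqP => ar0.
by move: r0; rewrite -ar0 eqn0Ngt => /outdeg_gt0P[]; exists b.
Qed.

(** The sink [s] lies in the weak component of [x], so it leads to [r]; but a sink leads only to
    itself. *)
Lemma drains_uniq A x r s :
  partial_function A -> drains A x r -> drains A x s -> r = s.
Proof.
move=> Af xr /andP[xs s0].
have /andP[sr _] := weak_component_drains Af xr (connect_step_weak xs).
exact: sink_connect s0 sr.
Qed.

(** * Converging forests in terms of directed reachability *)

Lemma outdeg_comp_arcs A x v :
  v \in comp_verts A x -> outdeg (comp_arcs A x) v = outdeg A v.
Proof.
rewrite inE => xv; apply: eq_card => e; rewrite !inE.
case: eqP => [sv|]; rewrite ?andbF ?andbT //; case: (boolP (e \in A)) => //= eA.
rewrite sv xv /=; apply: connect_trans xv (connect1 _); apply: step_weak.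
by apply/stepP; exists e.
Qed.

Lemma weakly_connected_comp_arcs A x :
  weakly_connected (comp_verts A x) (comp_arcs A x).
Proof.
have xP y : connect (weak_adj A) x y -> connect (weak_adj (comp_arcs A x)) x y.
  (* The invariant also keeps reachability in [A], which places both ends of each traversed arc in
     the component. *)
  move=> xy; pose P y := connect (weak_adj A) x y &&
    connect (weak_adj (comp_arcs A x)) x y.
  suff /andP[]: P y by [].
  apply: (connect_invariant _ xy); last by rewrite /P !connect0.
  move=> a b ab /andP[xa xa']; have xb := connect_trans xa (connect1 ab).
  rewrite /P xb; apply: connect_trans xa' (connect1 _).
  case/exists_inP: ab => e eA E; apply/exists_inP; exists e => //.
  by rewrite !inE eA; case/orP: E => /andP[/eqP -> /eqP ->]; rewrite xa xb.
apply/forall_inP => a; rewrite inE => /xP xa; apply/forall_inP => b.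
by rewrite inE => /xP xb; apply: connect_trans xb; rewrite weak_adj_sym.
Qed.

Lemma converging_tree_to_comp A x r :
  converging_tree_to (comp_verts A x) (comp_arcs A x) r =
  [&& r \in comp_verts A x, outdeg A r == 0%N
    & [forall v in comp_verts A x, (v != r) ==> (outdeg A v == 1%N)]].
Proof.
rewrite /converging_tree_to weakly_connected_comp_arcs /=.
case: (boolP (r \in _)) => //= rx; rewrite outdeg_comp_arcs //; congr andb.
by apply: eq_forallb_in => v vx; rewrite outdeg_comp_arcs.
Qed.

Lemma in_tree_converging_toE A x r :
  partial_function A -> in_tree_converging_to A x r = drains A x r.
Proof.
move=> Af; rewrite /in_tree_converging_to converging_tree_to_comp.
apply/idP/idP => [/and3P[]|xr].
  rewrite inE => xr r0 _; apply: (@weak_component_drains _ r) => //.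
    by rewrite /drains connect0 r0.
  by rewrite weak_adj_sym.
have /andP[xr' r0] := xr; rewrite inE connect_step_weak // r0 /=.
apply/forall_inP => v; rewrite inE => xv; apply/implyP => vr.
have /andP[/connectP[[|a p] /=]] := weak_component_drains Af xr xv.
  by move=> _ E; rewrite E eqxx in vr.
case/andP=> va _ _ _; rewrite eqn_leq (forallP Af) /=.
by apply/outdeg_gt0P; exists a.
Qed.

(** The second conjunct encodes acyclicity: from a cycle of a partial function no sink can be
    reached. *)
Lemma spanning_converging_forestE A :
  spanning_converging_forest A
    = partial_function A && [forall x, exists r, drains A x r].
Proof.
apply/idP/andP => [/forallP AF|[Af /forallP Ad]]; last first.
  apply/forallP => x; have /existsP[r xr] := Ad x.
  by apply/existsP; exists r; rewrite -in_tree_converging_toE in xr.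
have Af : partial_function A.
  apply/forallP => v; have /existsP[r] := AF v.
  rewrite converging_tree_to_comp => /and3P[_ /eqP r0 /forall_inP /(_ v)].
  rewrite inE connect0 => /(_ isT).
  by case: eqP => [->|_ /= /eqP ->] //; rewrite r0.
split=> //; apply/forallP => x; have /existsP[r xr] := AF x.
by apply/existsP; exists r; rewrite -in_tree_converging_toE.
Qed.

(** * Adding an arc that leaves a sink *)

Lemma outdeg_setU1 A e v : e \notin A ->
  outdeg (e |: A) v = ((src e == v) + outdeg A v)%N.
Proof.
move=> eA; rewrite /outdeg; case: eqP => [sv|nsv].
  rewrite (_ : finset _ = e |: [set a in A | src a == v]).
    by rewrite cardsU1 inE (negPf eA).
  by apply/setP => a; rewrite !inE andb_orl; case: eqP => // ->; rewrite sv eqxx.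
apply: eq_card => a; rewrite !inE andb_orl.
by case: (a =P e) => // ->; case: eqP.
Qed.

Lemma drains_exists A x :
  spanning_converging_forest A -> exists r, drains A x r.
Proof. by rewrite spanning_converging_forestE => /andP[_ /forallP/(_ x)/existsP]. Qed.

Lemma forest_partial_function A :
  spanning_converging_forest A -> partial_function A.
Proof. by rewrite spanning_converging_forestE => /andP[]. Qed.

Lemma connect_setU1 A e x y : connect (step A) x y -> connect (step (e |: A)) x y.
Proof.
apply: connect_sub => a b /stepP[e' [eA s t]]; apply: connect1.
by apply/stepP; exists e'; rewrite in_setU1 eA orbT.
Qed.

Section AddArc.

Variables (A : {set Defs.arc G}) (e : Defs.arc G).
Hypothesis src_sink : outdeg A (src e) == 0%N.

Lemma src_sink_notin : e \notin A.
Proof. by apply/negP => /(outdeg_eq0P _ _ src_sink); rewrite eqxx. Qed.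

Lemma partial_function_setU1 : partial_function (e |: A) = partial_function A.
Proof.
apply: eq_forallb => v; rewrite outdeg_setU1 ?src_sink_notin //.
by case: eqP => // <-; rewrite (eqP src_sink).
Qed.

Lemma drains_setU1 x r : r != src e -> drains A x r -> drains (e |: A) x r.
Proof.
move=> rv /andP[xr r0]; rewrite /drains connect_setU1 //.
by rewrite outdeg_setU1 ?src_sink_notin // [src e == r]eq_sym (negPf rv).
Qed.

Lemma drains_through_setU1 x r : r != src e ->
  drains A x (src e) -> drains A (tgt e) r -> drains (e |: A) x r.
Proof.
move=> rv /andP[xv _] /(drains_setU1 rv)/andP[tr r0]; rewrite /drains r0 andbT.
apply: connect_trans (connect_setU1 e xv) (connect_trans (connect1 _) tr).
by apply/stepP; exists e; rewrite setU11.
Qed.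

(** As [e] leaves a sink, the only obstruction is a cycle through [e], which arises exactly when
    [tgt e] already drains to [src e]. *)
Lemma forest_setU1 :
  spanning_converging_forest (e |: A)
    = spanning_converging_forest A && ~~ drains A (tgt e) (src e).
Proof.
rewrite !spanning_converging_forestE partial_function_setU1 -andbA.
case: (boolP (partial_function A)) => //= Af.
have Bf : partial_function (e |: A) by rewrite partial_function_setU1.
apply/forallP/andP => [AF|[/forallP AF nt] x].
  split.
    apply/forallP => x; have /existsP[r /andP[xr r0]] := AF x.
    (* A path in [e |: A] either avoids [e] or leads inside [A] to [src e] before its first use of
       [e]. *)
    have /orP[xr'|xv] : connect (step A) x r || connect (step A) x (src e).
    - move/connectP: xr => [p + ->]; elim: p x => [|a p IH] x /=.
        by rewrite connect0.
      case/andP=> /stepP[e' [+ s t]] /IH ar; rewrite in_setU1 => /orP[/eqP E|eA].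
        by rewrite -s E connect0 orbT.
      have xa : connect (step A) x a by apply: connect1; apply/stepP; exists e'.
      by case/orP: ar => /(connect_trans xa) ->; rewrite ?orbT.
    - apply/existsP; exists r; rewrite /drains xr'.
      by move: r0; rewrite outdeg_setU1 ?src_sink_notin // addn_eq0 => /andP[].
    - by apply/existsP; exists (src e); rewrite /drains xv.
  (* Otherwise [e] closes a cycle: whatever is reachable from [src e] leads back to it, even the
     sink [r], so [r] is [src e], which has an out-arc. *)
  apply/negP => /andP[tv _]; have /existsP[r /andP[vr r0]] := AF (src e).
  have vt : step (e |: A) (src e) (tgt e) by apply/stepP; exists e; rewrite setU11.
  have rv : connect (step (e |: A)) r (src e).
    apply: (connect_invariant (P := fun y => connect _ y (src e)) _ vr (connect0 _ _)).
    move=> a b ab av; case: (a =P src e) => [E|/eqP nav].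
      rewrite E in ab; rewrite (step_functional Bf ab vt); exact: connect_setU1.
    exact: connect_next Bf ab av nav.
  have E := sink_connect r0 rv; move: r0; rewrite -E eqn0Ngt => /outdeg_gt0P[].
  by exists (tgt e).
have /existsP[r xr] := AF x.
case: (r =P src e) => [E|/eqP rv]; last by apply/existsP; exists r; apply: drains_setU1.
have /existsP[s ts] := AF (tgt e).
apply/existsP; exists s; apply: (drains_through_setU1 _ _ ts); last by rewrite -E.
by apply: contraNneq nt => <-.
Qed.

(** Only the tree rooted at [src e] changes its root, being grafted onto the tree of [tgt e]. The
    forward direction finds a root of [x] in [e |: A] from the one in [A] and uses uniqueness. *)
Lemma drains_setU1E x r :
  spanning_converging_forest A -> ~~ drains A (tgt e) (src e) ->
  drains (e |: A) x r = (r != src e) && drains A x r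
                        || drains A x (src e) && drains A (tgt e) r.
Proof.
move=> AF nt.
have Bf : partial_function (e |: A).
  by rewrite partial_function_setU1 forest_partial_function.
have tneq s : drains A (tgt e) s -> s != src e by move=> ts; apply: contraNneq nt => <-.
apply/idP/orP => [xr|[/andP[rv xr]|/andP[xv tr]]].
- have [s xs] := drains_exists x AF.
  case: (s =P src e) => [E|/eqP sv].
    have [q tq] := drains_exists (tgt e) AF; rewrite E in xs.
    right; rewrite xs (drains_uniq Bf xr (drains_through_setU1 _ xs tq)) //.
    exact: tneq.
  by left; rewrite (drains_uniq Bf xr (drains_setU1 sv xs)) sv.
- exact: drains_setU1.
- exact: drains_through_setU1 (tneq _ tr) xv tr.
Qed.

End AddArc.

(** * Forest weights by deletion of the arc leaving a vertex *)

Lemma weight_setU1 A e : e \notin A -> weight (e |: A) = arc_weight e * weight A.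
Proof. exact: big_setU1. Qed.

(** A set satisfying [P] has no arc out of [v], or is uniquely [e |: A] with [e] leaving [v] and no
    such arc in [A]. *)
Lemma sum_delete_out_arc v (P : pred {set Defs.arc G}) (F : {set Defs.arc G} -> R) :
  (forall A, P A -> (outdeg A v <= 1)%N) ->
  \sum_(A | P A) F A =
  \sum_(A | outdeg A v == 0%N)
     ((P A)%:R * F A + \sum_(e : Defs.arc G | src e == v) (P (e |: A))%:R * F (e |: A)).
Proof.
move=> P1; rewrite (bigID (fun A => outdeg A v == 0%N)) /= [RHS]big_split /=.
congr (_ + _).
  by rewrite big_mkcondl; apply: eq_bigr => A _; rewrite mulr_natl mulrb.
(* Exactly one arc of [A] leaves [v], so the inner sum has a single term and turns that arc into an
   index. *)
transitivity (\sum_(A | P A && (outdeg A v != 0%N))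
                 \sum_(e | (src e == v) && (e \in A)) F A).
  apply: eq_bigr => A /andP[/P1 A1 A0].
  rewrite sumr_const (_ : #|_| = 1%N) //; apply/eqP.
  rewrite -[1%N](_ : outdeg A v = _); last first.
    by apply/eqP; rewrite eqn_leq A1 lt0n.
  by apply/eqP; apply: eq_card => e; rewrite !inE andbC.
rewrite (exchange_big_dep (fun e => src e == v)) /=; last by move=> A e _ /andP[].
rewrite [RHS]exchange_big /=; apply: eq_bigr => e sv.
rewrite (reindex_onto (fun A => e |: A) (fun A => A :\ e)) /=; last first.
  by move=> A /andP[_ /andP[_ eA]]; rewrite setD1K.
under [RHS]eq_bigr do rewrite mulr_natl mulrb.
rewrite -big_mkcondr /=; apply: eq_bigl => A; rewrite setU11 sv /= andbT.
case: (boolP (e \in A)) => [eA|eA].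
  rewrite (_ : _ == A = false); last first.
    by apply/negP => /eqP/setP/(_ e); rewrite !inE eqxx eA.
  by rewrite andbF; case: outdeg_eq0P => // /(_ e eA); rewrite sv.
rewrite setU1K // eqxx andbT outdeg_setU1 // sv /= andbT andbC.
case: (boolP (P _)) => [/P1|] //=.
by rewrite outdeg_setU1 // sv add1n ltnS leqn0 => ->.
Qed.

Definition out_weight v : R := \sum_(e : Defs.arc G | src e == v) arc_weight e.

Definition drain_ind A x r : R := (drains A x r)%:R.

Definition out_weight_to A v r : R :=
  \sum_(e : Defs.arc G | src e == v) arc_weight e * drain_ind A (tgt e) r.

Lemma forest_weightE x r :
  forest_weight G x r
    = \sum_(A | spanning_converging_forest A && drains A x r) weight A.
Proof.
apply: eq_bigl => A; case: (boolP (spanning_converging_forest A)) => //= AF.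
by rewrite in_tree_converging_toE // forest_partial_function.
Qed.

(* The forests containing no arc out of v index the sum: such a forest A extends
   by exactly those arcs e out of v whose target does not drain to v in A. *)
Lemma forest_weight_delete v x r : r != v ->
  forest_weight G x r =
  \sum_(A | (outdeg A v == 0%N) && spanning_converging_forest A)
     weight A * (drain_ind A x r * (1 + out_weight v - out_weight_to A v v)
                 + drain_ind A x v * out_weight_to A v r).
Proof.
move=> rv; rewrite forest_weightE (@sum_delete_out_arc v); last first.
  by move=> A /andP[/forest_partial_function/forallP].
rewrite [RHS]big_mkcondr /=; apply: eq_bigr => A v0.
case: (boolP (spanning_converging_forest A)) => /= AF; last first.
  rewrite mul0r add0r big1 // => e /eqP sv.
  by rewrite forest_setU1 ?sv // (negPf AF) mul0r.
rewrite -/(drain_ind A x r).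
(* The 0/1 conditions on [e |: A] become polynomials in indicators for [A], so that the sum over [e]
   is plain algebra. *)
transitivity (weight A * (drain_ind A x r + \sum_(e : Defs.arc G | src e == v) arc_weight e *
   (drain_ind A x r * (1 - drain_ind A (tgt e) v)
      + drain_ind A x v * drain_ind A (tgt e) r))).
  rewrite mulrDr mulr_sumr [_ * weight A]mulrC; congr (_ + _).
  apply: eq_bigr => e /eqP sv; rewrite -sv in v0 rv *.
  rewrite weight_setU1 ?src_sink_notin // forest_setU1 // AF /=.
  rewrite [RHS]mulrA [weight A * _]mulrC [RHS]mulrC; congr (_ * _).
  have Af := forest_partial_function AF.
  (* Distinct roots exclude each other, so the disjunction in [drains_setU1E] becomes a sum. *)
  have excl y : drains A y r -> drains A y (src e) -> False.
    by move=> yr yv; move: rv; rewrite (drains_uniq Af yr yv) eqxx.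
  rewrite /drain_ind; case: (boolP (drains A (tgt e) (src e))) => /= [tv|tv].
    case: (boolP (drains A (tgt e) r)) => [/excl/(_ tv)//|_].
    by rewrite subrr !mulr0 addr0.
  rewrite drains_setU1E // rv /= subr0 mulr1.
  case: (boolP (drains A x r)) => [xr|_] /=; last by rewrite add0r -natrM mulnb.
  case: (boolP (drains A x (src e))) => [/(excl _ xr)//|_].
  by rewrite mul0r addr0.
congr (_ * _); rewrite /out_weight /out_weight_to.
under eq_bigr => e _ do rewrite mulrDr mulrCA [X in _ + X]mulrCA mulrBr mulr1.
rewrite big_split /= -!mulr_sumr sumrB; ring.
Qed.

(** * Harmonicity of forest weights and the minimum principle *)

Lemma weight_gt0 A : positive_weights G -> 0 < weight A.
Proof. by move=> Gpos; apply: prodr_gt0 => e _; apply: Gpos. Qed.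

Lemma forest_weight_gt0 r : positive_weights G -> 0 < forest_weight G r r.
Proof.
move=> Gpos; rewrite forest_weightE (bigD1 set0) /=; last first.
  have out0 v : outdeg (set0 : {set Defs.arc G}) v = 0%N.
    by apply/eqP/outdeg_eq0P => e; rewrite inE.
  have dr x : drains (set0 : {set Defs.arc G}) x x by rewrite /drains connect0 out0.
  rewrite spanning_converging_forestE dr andbT; apply/andP; split.
    by apply/forallP => v; rewrite out0.
  by apply/forallP => x; apply/existsP; exists x.
by apply: ltr_wpDr (weight_gt0 _ Gpos); apply: sumr_ge0 => A _; apply/ltW/weight_gt0.
Qed.

(** A forest in which [x] drains to [r] has [r] as a root, so it is also counted on the right. *)
Lemma forest_weight_le_diag x r :
  positive_weights G -> forest_weight G x r <= forest_weight G r r.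
Proof.
move=> Gpos; rewrite !forest_weightE big_mkcond [leRHS]big_mkcond /=.
apply: ler_sum => A _; case: (boolP (spanning_converging_forest A)) => //= _.
have A0 := ltW (weight_gt0 A Gpos).
case: (boolP (drains A x r)) => [/andP[_ r0]|_]; last by case: ifP.
by rewrite /drains connect0 r0.
Qed.

(** Both sides expand over the forests [A] with no arc out of [v], where [v] is its own root.
    Writing T_s for [out_weight_to A v s] and D for [out_weight v], the right side has coefficient
    T_r (1 + D - T_v) + T_v T_r = (1 + D) T_r. *)
Lemma forest_weight_harmonic v r : r != v ->
  (1 + out_weight v) * forest_weight G v r
    = \sum_(e : Defs.arc G | src e == v) arc_weight e * forest_weight G (tgt e) r.
Proof.
move=> rv; rewrite (forest_weight_delete _ rv).
under [RHS]eq_bigr => e _ do rewrite (forest_weight_delete _ rv) mulr_sumr.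
rewrite exchange_big mulr_sumr /=; apply: eq_bigr => A /andP[v0 AF].
have vv : drains A v v by rewrite /drains connect0.
have -> : drain_ind A v r = 0.
  rewrite /drain_ind; case: (boolP (drains A v r)) => // vr.
  by rewrite (drains_uniq (forest_partial_function AF) vr vv) eqxx in rv.
rewrite {1}/drain_ind vv.
under eq_bigr => e _ do rewrite mulrCA mulrDr [X in X + _]mulrA [X in _ + X]mulrA.
by rewrite -mulr_sumr big_split /= -!mulr_suml -!/(out_weight_to _ _ _); ring.
Qed.

Lemma forest_weight_superharmonic r : positive_weights G ->
  \sum_(e : Defs.arc G | src e == r) arc_weight e * forest_weight G (tgt e) r
    < (1 + out_weight r) * forest_weight G r r.
Proof.
move=> Gpos; rewrite mulrDl mul1r addrC; apply: ltr_pwDr (forest_weight_gt0 r Gpos) _.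
rewrite mulr_suml; apply: ler_sum => e _.
by rewrite ler_pM2l ?Gpos // forest_weight_le_diag.
Qed.

(** At a minimiser [m] other than [j], the sum is at least [out_weight m * y m]; the summand 1 then
    leaves [0 <= y m]. *)
Lemma minimum_principle j (y : V -> R) : positive_weights G -> 0 <= y j ->
  (forall v, v != j -> \sum_(e : Defs.arc G | src e == v) arc_weight e * y (tgt e)
                       <= (1 + out_weight v) * y v) ->
  forall v, 0 <= y v.
Proof.
move=> Gpos yj0 ysup v.
case: (@Order.TotalTheory.arg_minP _ _ _ j xpredT y isT) => m _ ym.
apply: le_trans (ym v isT); case: (m =P j) => [->//|/eqP/ysup].
rewrite mulrDl mul1r addrC -lerBlDl; apply: le_trans.
rewrite mulr_suml -sumrB; apply: sumr_ge0 => e _.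
by rewrite -mulrBr mulr_ge0 ?subr_ge0 ?ym // ltW.
Qed.

(** * The gap between the two sides of the inequality *)

Section Transit.

Variables (j k : V).
Hypothesis G_pos : positive_weights G.

Definition transit_gap v : R :=
  forest_weight G v k * forest_weight G j j - forest_weight G v j * forest_weight G j k.

Lemma transit_gap_id : transit_gap j = 0.
Proof. by rewrite /transit_gap mulrC subrr. Qed.

Lemma sum_transit_gap v :
  \sum_(e : Defs.arc G | src e == v) arc_weight e * transit_gap (tgt e) =
  (\sum_(e : Defs.arc G | src e == v) arc_weight e * forest_weight G (tgt e) k) * forest_weight G j j
  - (\sum_(e : Defs.arc G | src e == v) arc_weight e * forest_weight G (tgt e) j) * forest_weight G j k.
Proof.
by rewrite !mulr_suml -sumrB; apply: eq_bigr => e _; rewrite mulrBr !mulrA.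
Qed.

Lemma transit_gap_harmonic v : v != j -> v != k ->
  \sum_(e : Defs.arc G | src e == v) arc_weight e * transit_gap (tgt e)
    = (1 + out_weight v) * transit_gap v.
Proof.
move=> vj vk; rewrite sum_transit_gap -!forest_weight_harmonic 1?eq_sym //.
by rewrite /transit_gap mulrBr !mulrA.
Qed.

(** Strictness comes from the first product: weights to root [k] are strictly superharmonic at [k]
    and [f_jj] is positive, while weights to root [j] are harmonic there. *)
Lemma transit_gap_superharmonic : k != j ->
  \sum_(e : Defs.arc G | src e == k) arc_weight e * transit_gap (tgt e)
    < (1 + out_weight k) * transit_gap k.
Proof.
move=> kj; rewrite sum_transit_gap -[X in _ - X * _]forest_weight_harmonic 1?eq_sym //.
rewrite /transit_gap mulrBr !mulrA ltrD2r ltr_pM2r ?forest_weight_gt0 //.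
exact: forest_weight_superharmonic.
Qed.

Lemma transit_gap_ge0 v : 0 <= transit_gap v.
Proof.
apply: (@minimum_principle j) v => [//||v vj]; first by rewrite transit_gap_id.
case: (v =P k) vj => [->|/eqP vk] vj; first exact/ltW/transit_gap_superharmonic.
by rewrite transit_gap_harmonic.
Qed.

Lemma transit_gap_eq0_path i p :
  transit_gap i = 0 -> path (adj G) i p -> last i p = k -> j \in i :: p.
Proof.
have terms_ge0 v e : src e == v -> 0 <= arc_weight e * transit_gap (tgt e).
  by move=> _; rewrite mulr_ge0 ?transit_gap_ge0 // ltW.
(* A zero at [k] with [k != j] would make a sum of nonnegative terms negative. *)
have yk0 : transit_gap k = 0 -> k = j.
  move=> yk; apply/eqP; apply: contraT => /transit_gap_superharmonic.
  by rewrite yk mulr0 ltNge sumr_ge0 // => e; apply: terms_ge0.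
elim: p i => [|a p IH] i /= yi0.
  by move=> _ ik; rewrite ik in yi0 *; rewrite (yk0 yi0) inE eqxx.
case/andP=> /existsP[e /andP[si /eqP ta]] ap lk; rewrite inE.
case: eqVneq => //= ji; apply: IH ap lk.
have ik : i != k by apply: contra_neq ji => ik; rewrite ik in yi0 *; rewrite yk0.
have S0 : \sum_(e : Defs.arc G | src e == i) arc_weight e * transit_gap (tgt e) = 0.
  by rewrite (transit_gap_harmonic _ ik) ?yi0 ?mulr0 // eq_sym.
move/eqP: S0; rewrite psumr_eq0; last by move=> e'; apply: terms_ge0.
move/allP/(_ e (mem_index_enum _))/implyP/(_ si).
by rewrite ta mulf_eq0 gt_eqF ?G_pos //= => /eqP.
Qed.

Lemma transit_gap_eq0 i :
  (forall p, dipath G i p k -> j \in i :: p) -> transit_gap i = 0.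
Proof.
move=> through; have [->|ij] := eqVneq i j; first exact: transit_gap_id.
(* Steps may not enter [j]; as [i] is not [j], walks from [i] along [avoid] miss [j] altogether. *)
pose avoid := [rel a b | adj G a b && (b != j)].
pose z v := if connect avoid i v then - transit_gap v else 0.
have z_le0 v : z v <= 0 by rewrite /z; case: ifP => // _; rewrite oppr_le0 transit_gap_ge0.
suff: 0 <= z i.
  by rewrite /z connect0 oppr_ge0 => yi; apply: le_anti; rewrite yi transit_gap_ge0.
apply: (@minimum_principle j) => [//||v vj].
  by rewrite /z transit_gap_id oppr0; case: ifP.
rewrite [in leRHS]/z; case: (boolP (connect avoid i v)) => iv; last first.
  by rewrite mulr0; apply: sumr_le0 => e _; rewrite mulr_ge0_le0 // ltW.
(* If [k] were reached, shortening the walk would give a path from [i] to [k] that misses [j]. *)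
have vk : v != k.
  apply: contraTneq iv => ->; apply/connectP => -[p].
  case/shortenP=> q iq Uq _ lk.
  have /through : dipath G i q k.
    rewrite /dipath -lk eqxx Uq /= andbT.
    by apply: sub_path iq => a b /= /andP[].
  rewrite inE eq_sym (negPf ij) /= => jq.
  clear -iq jq; elim: q i iq jq => //= a q IH i /andP[/andP[_ aj] aq].
  by rewrite inE eq_sym (negPf aj) /=; apply: IH aq.
rewrite mulrN -transit_gap_harmonic // -sumrN; apply: ler_sum => e /eqP sv.
rewrite -mulrN ler_pM2l // /z; case: ifP => // /negbT nt.
(* An arc leaving the reachable region can only enter [j], where the gap vanishes, so the cutoff
   changes nothing there. *)
suff -> : tgt e = j by rewrite transit_gap_id oppr0.
apply: contraNeq nt => tj; apply: connect_trans iv (connect1 _).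
by rewrite /= tj andbT; apply/existsP; exists e; rewrite sv !eqxx.
Qed.

End Transit.
End ForestWeights.

Theorem theorem1 (R : realFieldType) (n : nat) (n_gt1 : (1 < n)%N)
    (G : wmultidigraph R 'I_n) (G_loopless : loopless G)
    (G_pos : positive_weights G) (i j k : 'I_n) :
  forest_weight G i j * forest_weight G j k
    <= forest_weight G i k * forest_weight G j j
  /\ (forest_weight G i j * forest_weight G j k
        = forest_weight G i k * forest_weight G j j
      <-> forall p : seq 'I_n, dipath G i p k -> j \in i :: p).
Proof.
split; first by rewrite -subr_ge0; apply: transit_gap_ge0.
split=> [E p /and3P[ip /eqP lk _]|through].
  by apply: transit_gap_eq0_path ip lk => //; rewrite /transit_gap E subrr.
by apply/esym/eqP; rewrite -subr_eq0; apply/eqP; apply: transit_gap_eq0.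
Qed.
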